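(* Let $k$ be a positive integer. Then the even part $\pi_1^3(KG_{2k+1,k})_{ev}$ of the $3$-fundamental group of the Kneser graph $KG_{2k+1,k}$ is trivial. Hence $\pi_1^3(KG_{2k+1,k})\cong\mathbb{Z}/2$.
   Context: A graph is a pair $G=(V(G),E(G))$ with $V(G)$ a set and $E(G)\subset V(G)\times V(G)$ a symmetric subset. A graph homomorphism is a map of vertex sets sending edges to edges. For positive integers $n\ge 2k$, the Kneser graph $KG_{n,k}$ has as vertices the $k$-element subsets of $\{0,1,\dots,n-1\}$, two of them being adjacent if and only if they are disjoint. For $n>2k$ it is connected. $r$-fundamental group ($r$ a positive integer). $L_n$ ($n\ge 0$) is the graph with $V(L_n)=\{0,1,\dots,n\}$ and $E(L_n)=\{(x,y): |x-y|=1\}$. A path of length $n$ in $G$ is a graph homomorphism $\varphi:L_n\to G$; write $l(\varphi)=n$; it joins $\varphi(0)$ to $\varphi(n)$. On the set of paths joining $v$ to $w$, let $\simeq_r$ be the equivalence relation generated by the following two conditions on a pair $\varphi,\psi$: (A) $l(\psi)=l(\varphi)+2$ and there is $x\in\{0,\dots,l(\varphi)\}$ with $\psi(i)=\varphi(i)$ for $i\le x$ and $\psi(i+2)=\varphi(i)$ for $i\ge x$; (B)$_r$ $l(\varphi)=l(\psi)$ and $\#\{i: 0\le i\le l(\varphi),\ \varphi(i)\ne\psi(i)\}<r$. $\pi_1^r(G,v)$ is the set of $\simeq_r$-classes of paths from $v$ to $v$, with group operation induced by concatenation, $[\psi]_r\cdot[\varphi]_r=[\psi\cdot\varphi]_r$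 ($\varphi$ followed by $\psi$). The even part $\pi_1^r(G,v)_{ev}$ is the kernel of the well-defined homomorphism $\pi_1^r(G,v)\to\mathbb{Z}/2$, $[\varphi]_r\mapsto l(\varphi)\bmod 2$. For connected $G$ the isomorphism class of $\pi_1^r(G,v)$ does not depend on $v$, and the basepoint is omitted from the notation; the statement holds for every choice of basepoint. *)

(* Defs.v *)
From HB Require Import structures.
From Stdlib Require Import Relation_Operators.
From mathcomp Require Import all_boot all_order all_algebra all_fingroup.
From mathcomp Require Import generic_quotient zify.
From mathcomp Require Import boolp classical_sets.

Set Implicit Arguments.
Unset Strict Implicit.
Unset Printing Implicit Defensive.

Record graph := Graph {
  vertex : Type;
  edge : vertex -> vertex -> Prop;
  edge_sym : forall x y, edge x y -> edge y x }.

Record graph_hom (G H : graph) := GraphHom {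
  hom_fun :> vertex G -> vertex H;
  hom_edge : forall x y, edge x y -> edge (hom_fun x) (hom_fun y) }.

Definition line_edge n (x y : 'I_n.+1) : Prop :=
  (y = x.+1 :> nat) \/ (x = y.+1 :> nat).

Lemma line_edge_sym n (x y : 'I_n.+1) : line_edge x y -> line_edge y x.
Proof. by case=> ?; [right | left]. Qed.

Definition line n : graph := Graph (@line_edge_sym n).

Section Kneser.
Variables n k : nat.

Definition kneser_edge (A B : {A : {set 'I_n} | #|A| == k}) : Prop :=
  [disjoint val A & val B].

Lemma kneser_edge_sym A B : kneser_edge A B -> kneser_edge B A.
Proof. by rewrite /kneser_edge disjoint_sym. Qed.

Definition kneser : graph := Graph kneser_edge_sym.
End Kneser.

Record gpath (G : graph) (v w : vertex G) := GPath {
  plen : nat;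
  pmap : graph_hom (line plen) G;
  pmap_start : pmap (@ord0 plen) = v;
  pmap_end : pmap (@ord_max plen) = w }.

(* [pt p i] is the i-th vertex of [p]; it is meaningful for [i <= plen p] only,
   where [inord i] is [i]. *)
Definition pt G (v w : vertex G) (p : gpath v w) (i : nat) : vertex G :=
  pmap p (inord i).

Section PathBasics.
Variable G : graph.
Implicit Types u v w : vertex G.

Lemma pt0 v w (p : gpath v w) : pt p 0 = v.
Proof.
rewrite /pt -[RHS](pmap_start p); congr (pmap p _).
by apply: val_inj; rewrite /= inordK.
Qed.

Lemma pt_plen v w (p : gpath v w) : pt p (plen p) = w.
Proof.
rewrite /pt -[RHS](pmap_end p); congr (pmap p _).
by apply: val_inj; rewrite /= inordK.
Qed.

Lemma pt_edge v w (p : gpath v w) i : i < plen p ->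
  edge (pt p i) (pt p i.+1).
Proof. by move=> lti; apply: hom_edge; left; rewrite !inordK ?ltnS // ltnW. Qed.

Lemma gpath_eq v w (p q : gpath v w) : plen p = plen q ->
  (forall i, i <= plen p -> pt p i = pt q i) -> p = q.
Proof.
case: p q => [n [f fe] f0 fn] [m [g ge] g0 gm] /= enm.
case: m / enm g ge g0 gm => g ge g0 gm fg.
have efg : f = g.
  apply/funext => i; have := fg i; rewrite /pt /= inord_val; apply.
  by rewrite -ltnS.
case: g / efg ge g0 gm fg => ge g0 gm _.
have ee : fe = ge by apply: Prop_irrelevance.
case: ge / ee g0 gm => g0 gm.
by congr GPath; apply: Prop_irrelevance.
Qed.

Section PathOf.
Variables (v w : vertex G) (n : nat) (f : nat -> vertex G).
Hypothesis fe : forall i, i < n -> edge (f i) (f i.+1).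
Hypotheses (f0 : f 0 = v) (fn : f n = w).

Lemma path_of_edge (x y : vertex (line n)) :
  edge x y -> edge (f (nat_of_ord x)) (f (nat_of_ord y)).
Proof.
move: x y => x y /= [exy|exy].
  by rewrite exy; apply: fe; rewrite -ltnS -exy.
by apply: edge_sym; rewrite exy; apply: fe; rewrite -ltnS -exy.
Qed.

Definition path_of : gpath v w :=
  @GPath G v w n (@GraphHom (line n) G (fun i => f (nat_of_ord i)) path_of_edge)
    f0 fn.

Lemma pt_path_of i : i <= n -> pt path_of i = f i.
Proof. by move=> lein; rewrite /pt /= inordK. Qed.
End PathOf.

Definition const_path v : gpath v v :=
  @path_of v v 0 (fun=> v) (fun i (h : i < 0) => False_ind _ (notF h)) erefl erefl.

Section Concat.
Variables (v w u : vertex G) (q : gpath w u) (p : gpath v w).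

Definition concat_fun i := if i <= plen p then pt p i else pt q (i - plen p).

Lemma concat_edge i : i < plen p + plen q ->
  edge (concat_fun i) (concat_fun i.+1).
Proof.
move=> lti; rewrite /concat_fun; case: (ltngtP i (plen p)) => [ltip|gtip|ei].
- exact: pt_edge.
- by rewrite subSn 1?ltnW //; apply: pt_edge; lia.
- by rewrite ei pt_plen -{1}(pt0 q) subSn // subnn; apply: pt_edge; lia.
Qed.

Lemma concat_start : concat_fun 0 = v.
Proof. exact: pt0. Qed.

Lemma concat_end : concat_fun (plen p + plen q) = u.
Proof.
rewrite /concat_fun; case: leqP => [le|_]; last by rewrite addKn pt_plen.
have q0 : plen q = 0 by lia.
by rewrite q0 addn0 pt_plen -(pt0 q) -q0 pt_plen.
Qed.

(* As in the product of classes [q].[p] = [q.p], [concat q p] is [p] followed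
   by [q]. *)
Definition concat : gpath v u := path_of concat_edge concat_start concat_end.

Lemma plen_concat : plen concat = plen p + plen q. Proof. by []. Qed.

Lemma pt_concatl i : i <= plen p -> pt concat i = pt p i.
Proof.
by move=> lei; rewrite pt_path_of /concat_fun ?lei //; apply: leq_trans lei (leq_addr _ _).
Qed.

Lemma pt_concatr i : i <= plen q -> pt concat (plen p + i) = pt q i.
Proof.
move=> lei; rewrite pt_path_of ?leq_add2l // /concat_fun.
case: leqP => [le|_]; last by rewrite addKn.
have -> : i = 0 by lia.
by rewrite addn0 pt_plen pt0.
Qed.
End Concat.

Section Reverse.
Variables (v w : vertex G) (p : gpath v w).

Lemma rev_edge i : i < plen p -> edge (pt p (plen p - i)) (pt p (plen p - i.+1)).
Proof.
move=> lti; apply: edge_sym.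
have -> : plen p - i = (plen p - i.+1).+1 by lia.
by apply: pt_edge; lia.
Qed.

Lemma rev_start : pt p (plen p - 0) = w.
Proof. by rewrite subn0 pt_plen. Qed.

Lemma rev_end : pt p (plen p - plen p) = v.
Proof. by rewrite subnn pt0. Qed.

Definition rev_path : gpath w v :=
  @path_of w v (plen p) (fun i => pt p (plen p - i)) rev_edge rev_start rev_end.

Lemma pt_rev i : i <= plen p -> pt rev_path i = pt p (plen p - i).
Proof. by move=> lei; rewrite pt_path_of. Qed.
End Reverse.

Lemma rev_pathK v w (p : gpath v w) : rev_path (rev_path p) = p.
Proof.
by apply: gpath_eq => // i lei; rewrite pt_rev // pt_rev ?leq_subr // subKn.
Qed.

End PathBasics.

Section Equivalence.
Variables (G : graph) (r : nat).
Implicit Types u v w : vertex G.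

Definition condA v w (p q : gpath v w) : Prop :=
  plen q = plen p + 2 /\
  exists x, [/\ x <= plen p,
    forall i, i <= x -> pt q i = pt p i &
    forall i, x <= i <= plen p -> pt q (i + 2) = pt p i].

Definition condB v w (p q : gpath v w) : Prop :=
  plen p = plen q /\
  #|[pred i : 'I_(plen p).+1 | `[< pt p i <> pt q i >]]| < r.

Definition path_equiv v w : gpath v w -> gpath v w -> Prop :=
  clos_refl_sym_trans (gpath v w) (fun p q => condA p q \/ condB p q).

Lemma card_count n (P : pred nat) :
  #|[pred i : 'I_n.+1 | P i]| = count P (iota 0 n.+1).
Proof.
by rewrite -sum1_card -sum1_count -[iota 0 _]/(index_iota 0 n.+1) big_mkord.
Qed.

Lemma condA_concatl v w u (q q' : gpath w u) (p : gpath v w) :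
  condA q q' -> condA (concat q p) (concat q' p).
Proof.
case=> lq [x [lex qx qx2]]; split; first by rewrite !plen_concat lq addnA.
exists (plen p + x); split => [|i lei|i /andP[lexi lei]].
- by rewrite leq_add2l.
- have [leip|ltpi] := leqP i (plen p); first by rewrite !pt_concatl.
  by rewrite -(subnKC (ltnW ltpi)) !pt_concatr ?qx //; lia.
- rewrite plen_concat in lei.
  have lepi : plen p <= i by lia.
  by rewrite -(subnKC lepi) -addnA !pt_concatr ?qx2 //; lia.
Qed.

Lemma condA_concatr v w u (q : gpath w u) (p p' : gpath v w) :
  condA p p' -> condA (concat q p) (concat q p').
Proof.
case=> lp [x [lex px px2]]; split; first by rewrite !plen_concat lp; lia.
exists x; split => [|i lei|i /andP[lexi lei]].
- by rewrite plen_concat; lia.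
- by rewrite !pt_concatl ?px //; lia.
- rewrite plen_concat in lei.
  have [leip|ltpi] := leqP i (plen p).
    by rewrite !pt_concatl ?px2 //; lia.
  rewrite -(subnKC (ltnW ltpi)) pt_concatr; last by lia.
  rewrite addnAC -lp pt_concatr //; lia.
Qed.

Lemma condB_concatl v w u (q q' : gpath w u) (p : gpath v w) :
  condB q q' -> condB (concat q p) (concat q' p).
Proof.
case=> lq dq; split; first by rewrite !plen_concat lq.
apply: leq_ltn_trans dq.
rewrite !(card_count _ (fun i => `[< pt _ i <> pt _ i >])) plen_concat.
rewrite -addSn iotaD count_cat add0n.
rewrite (@eq_in_count _ _ pred0 (iota 0 _)) ?count_pred0 ?add0n; last first.
  move=> i; rewrite mem_iota => /andP[_ lti]; apply/asboolPn => /=.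
  by rewrite !pt_concatl //; lia.
rewrite -addn1 iotaDl count_map -[X in _ <= X]/(_ + _).
apply: leq_trans (leq_addl _ _).
apply: eq_leq; apply: eq_in_count => i; rewrite mem_iota => /andP[_ lti] /=.
by rewrite !pt_concatr //; lia.
Qed.

Lemma condB_concatr v w u (q : gpath w u) (p p' : gpath v w) :
  condB p p' -> condB (concat q p) (concat q p').
Proof.
case=> lp dp; split; first by rewrite !plen_concat lp.
apply: leq_ltn_trans dp.
rewrite !(card_count _ (fun i => `[< pt _ i <> pt _ i >])) plen_concat.
rewrite -addSn iotaD count_cat add0n.
rewrite (@eq_in_count _ _ pred0 (iota (plen p).+1 _)) ?count_pred0 ?addn0; last first.
  move=> i; rewrite mem_iota => /andP[lei lti]; apply/asboolPn => /=.
  rewrite -(subnKC (ltnW lei)) pt_concatr; last by lia.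
  by rewrite lp pt_concatr //; lia.
apply: eq_leq; apply: eq_in_count => i; rewrite mem_iota => /andP[_ lti].
by rewrite !pt_concatl //; lia.
Qed.

Lemma path_equiv_concat v w u (q q' : gpath w u) (p p' : gpath v w) :
  path_equiv q q' -> path_equiv p p' -> path_equiv (concat q p) (concat q' p').
Proof.
move=> qq' pp'; apply: (@rst_trans _ _ _ (concat q' p)).
  elim: qq' => [a b [/condA_concatl h|/condB_concatl h]|a|a b _ h|a b c _ h _ h'].
  - by apply: rst_step; left; apply: h.
  - by apply: rst_step; right; apply: h.
  - exact: rst_refl.
  - exact: rst_sym.
  - exact: rst_trans h h'.
elim: pp' => [a b [/condA_concatr h|/condB_concatr h]|a|a b _ h|a b c _ h _ h'].
- by apply: rst_step; left; apply: h.
- by apply: rst_step; right; apply: h.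
- exact: rst_refl.
- exact: rst_sym.
- exact: rst_trans h h'.
Qed.

Lemma concatA v w u t (s : gpath u t) (q : gpath w u) (p : gpath v w) :
  concat s (concat q p) = concat (concat s q) p.
Proof.
apply: gpath_eq; first by rewrite !plen_concat addnA.
rewrite !plen_concat => i lei.
have [leip|/ltnW lepi] := leqP i (plen p).
  by rewrite [RHS]pt_concatl // !pt_concatl ?plen_concat //; lia.
have [leiq|/ltnW leqi] := leqP i (plen p + plen q).
  rewrite pt_concatl ?plen_concat // -(subnKC lepi) pt_concatr; last by lia.
  by rewrite pt_concatr ?plen_concat ?pt_concatl //; lia.
rewrite -{1}(subnKC leqi) -(plen_concat q p) pt_concatr; last by rewrite plen_concat; lia.
have -> : i = plen p + (plen q + (i - plen (concat q p))) by rewrite plen_concat; lia.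
rewrite pt_concatr ?plen_concat; last by lia.
rewrite pt_concatr; last by lia.
by congr pt; lia.
Qed.

Lemma concat_constl v w (p : gpath v w) : concat (const_path w) p = p.
Proof.
apply: gpath_eq; first by rewrite plen_concat addn0.
by move=> i; rewrite plen_concat addn0 => lei; rewrite pt_concatl.
Qed.

Lemma concat_constr v w (p : gpath v w) : concat p (const_path v) = p.
Proof.
apply: gpath_eq => // i; rewrite plen_concat => lei.
exact: (@pt_concatr _ _ _ _ p (const_path v)).
Qed.

Section Spur.
Variables (v w : vertex G) (p : gpath v w).

Definition spur_fun m i := if i <= m then pt p i else pt p (2 * m - i).

Lemma spur_edge m : m <= plen p -> forall i, i < 2 * m ->
  edge (spur_fun m i) (spur_fun m i.+1).
Proof.
move=> lem i lti; rewrite /spur_fun; case: (ltnP i m) => ltim.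
  by rewrite (ltnW ltim); apply: pt_edge; lia.
have -> : (if i <= m then pt p i else pt p (2 * m - i)) = pt p (2 * m - i).
  by case: leqP => // leim; congr pt; lia.
apply: edge_sym; have -> : 2 * m - i = (2 * m - i.+1).+1 by lia.
by apply: pt_edge; lia.
Qed.

Lemma spur_start m : spur_fun m 0 = v. Proof. exact: pt0. Qed.

Lemma spur_end m : spur_fun m (2 * m) = v.
Proof.
rewrite /spur_fun subnn pt0; case: leqP => // lem.
by have -> : m = 0 by [lia]; rewrite muln0 pt0.
Qed.

Definition spur m (lem : m <= plen p) : gpath v v :=
  path_of (spur_edge lem) (spur_start m) (spur_end m).

Lemma spur_equiv m (lem : m <= plen p) : path_equiv (const_path v) (spur lem).
Proof.
elim: m lem => [|m IH] lem.
  have <- : const_path v = spur lem; last exact: rst_refl.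
  apply: gpath_eq => // i; rewrite leqn0 => /eqP ->.
  by rewrite !pt0.
apply: (rst_trans _ _ _ _ _ (IH (ltnW lem))).
apply: rst_step; left; split; first by rewrite /=; lia.
exists m; split => [|i lei|i /andP[lemi lei]].
- by rewrite /=; lia.
- rewrite pt_path_of; last by lia.
  by rewrite pt_path_of /spur_fun ?lei ?(leqW lei) //; lia.
- move: lei => /= lei; rewrite pt_path_of; last by lia.
  rewrite pt_path_of // /spur_fun.
  case: leqP => [|_]; first by lia.
  by case: leqP => h; congr pt; lia.
Qed.

Lemma concat_rev : path_equiv (concat (rev_path p) p) (const_path v).
Proof.
have -> : concat (rev_path p) p = spur (leqnn (plen p)).
  apply: gpath_eq; first by rewrite /=; lia.
  rewrite plen_concat /= => i lei; rewrite [RHS]pt_path_of /spur_fun; last by lia.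
  case: leqP => [leip|/ltnW lepi]; first by rewrite pt_concatl.
  rewrite -{1}(subnKC lepi) pt_concatr ?pt_rev /=; try lia.
  by congr pt; lia.
by apply: rst_sym; apply: spur_equiv.
Qed.
End Spur.

Lemma path_equiv_parity v w (p q : gpath v w) :
  path_equiv p q -> odd (plen p) = odd (plen q).
Proof.
elim=> [a b [[-> _]|[-> _]]|a|a b _ ->|a b c _ -> _ ->] //.
by rewrite oddD addbF.
Qed.

HB.instance Definition _ v w := gen_eqMixin (gpath v w).
HB.instance Definition _ v w := gen_choiceMixin (gpath v w).

Definition path_equivb v w : rel (gpath v w) := fun p q => `[< path_equiv p q >].

Lemma path_equivb_refl v w : reflexive (@path_equivb v w).
Proof. by move=> p; apply/asboolP; apply: rst_refl. Qed.

Lemma path_equivb_sym v w : symmetric (@path_equivb v w).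
Proof. by move=> p q; apply/asboolP/asboolP; apply: rst_sym. Qed.

Lemma path_equivb_trans v w : transitive (@path_equivb v w).
Proof.
by move=> q p s /asboolP pq /asboolP qs; apply/asboolP; apply: rst_trans pq qs.
Qed.

Canonical path_equiv_rel v w :=
  EquivRel (@path_equivb v w) (@path_equivb_refl v w) (@path_equivb_sym v w)
    (@path_equivb_trans v w).

End Equivalence.

Section FundamentalGroup.
Local Open Scope quotient_scope.
Variables (G : graph) (r : nat) (v : vertex G).

Definition pi1 := {eq_quot (path_equiv_rel r v v)}.
HB.instance Definition _ := Choice.on pi1.
HB.instance Definition _ := EqQuotient.on pi1.

Definition pi1_class (p : gpath v v) : pi1 := \pi_pi1 p.

Lemma pi1_classP (p q : gpath v v) :
  pi1_class p = pi1_class q <-> path_equiv r p q.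
Proof.
split=> [/(@eqquotP _ (path_equiv_rel r v v) pi1) /asboolP//|h].
by apply/(@eqquotP _ (path_equiv_rel r v v) pi1)/asboolP.
Qed.

Lemma pi1_repr (a : pi1) : pi1_class (repr a) = a.
Proof. exact: reprK. Qed.

Definition pi1_mul (a b : pi1) : pi1 := pi1_class (concat (repr a) (repr b)).
Definition pi1_one : pi1 := pi1_class (const_path v).
Definition pi1_inv (a : pi1) : pi1 := pi1_class (rev_path (repr a)).

Lemma pi1_mulE (p q : gpath v v) :
  pi1_mul (pi1_class p) (pi1_class q) = pi1_class (concat p q).
Proof.
by apply/pi1_classP/path_equiv_concat; apply/pi1_classP; rewrite pi1_repr.
Qed.

Lemma pi1_mulA : associative pi1_mul.
Proof.
move=> a b c; rewrite -(pi1_repr a) -(pi1_repr b) -(pi1_repr c).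
by rewrite !pi1_mulE concatA.
Qed.

Lemma pi1_mul1g : left_id pi1_one pi1_mul.
Proof. by move=> a; rewrite -(pi1_repr a) pi1_mulE concat_constl. Qed.

Lemma pi1_mulg1 : right_id pi1_one pi1_mul.
Proof. by move=> a; rewrite -(pi1_repr a) pi1_mulE concat_constr. Qed.

Lemma pi1_mulVg : left_inverse pi1_one pi1_inv pi1_mul.
Proof.
move=> a; rewrite -{2}(pi1_repr a) pi1_mulE.
by apply/pi1_classP; apply: concat_rev.
Qed.

Lemma pi1_mulgV : right_inverse pi1_one pi1_inv pi1_mul.
Proof.
move=> a; rewrite -{1}(pi1_repr a) pi1_mulE -{1}(rev_pathK (repr a)).
by apply/pi1_classP; apply: concat_rev.
Qed.

HB.instance Definition _ := isGroup.Build pi1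
  pi1_mulA pi1_mul1g pi1_mulg1 pi1_mulVg pi1_mulgV.

(* The [group_scope] structure of ['Z_2] is the additive one. *)
Definition pi1_parity (a : pi1) : 'Z_2 := inZp (plen (repr a)).

Lemma pi1_parity_class (p : gpath v v) : pi1_parity (pi1_class p) = inZp (plen p).
Proof.
have /pi1_classP/path_equiv_parity e := pi1_repr (pi1_class p).
by apply: val_inj; rewrite /= !modn2 e.
Qed.

Lemma pi1_parityM : {morph pi1_parity : a b / (a * b)%g}.
Proof.
move=> a b; rewrite -(pi1_repr a) -(pi1_repr b).
rewrite [X in pi1_parity X]pi1_mulE !pi1_parity_class.
by apply: val_inj; rewrite /= modnDm addnC.
Qed.

HB.instance Definition _ := isMultiplicative.Build pi1 'Z_2 pi1_parity pi1_parityM.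

Definition pi1_ev : set pi1 := [set a | pi1_parity a = 1%g].

End FundamentalGroup.

Arguments pi1_ev {G} r v.

(* Main.v *)
Require Import Defs.
From Stdlib Require Import Relation_Operators.
From mathcomp Require Import all_boot all_order all_algebra all_fingroup.
From mathcomp Require Import zify.
From mathcomp Require Import boolp.

(** The k-subsets of a (2k+1)-set and their complements, the (k+1)-subsets,
    form the two middle levels of the Boolean lattice.  Replacing every second
    vertex of a path of [KG_(2k+1,k)] by its complement turns a path into a walk
    in the inclusion graph of these two levels, which is thus the bipartite
    double cover of the Kneser graph: a vertex of the cover is a k-set together
    with the parity of its position on the path.  Walks with the same start in
    the cover end at the same vertex if and only if the original paths have the
    same end and the same parity, so it suffices to show that the middle level
    graph is simply connected once its hexagons are filled.  A hexagon is the
    difference between two paths of length 3 with the same ends, and such paths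
    differ in at most two places, so hexagons are null for the 3-homotopy
    relation.

    Simple connectivity comes from a height function: the Hamming distance to
    the base point [v].  Adjacent vertices of the cover differ by one element,
    hence their heights differ by exactly one; every vertex except [v] has a
    lower neighbour.  The one geometric fact ([height_hexagon]) is that two
    distinct lower neighbours of a vertex [w] always lie with [w] on a hexagon
    whose opposite vertex is three levels below [w]: if the two neighbours move
    [x] and [x'] in the direction of [v], then there is an element [z] that has
    to move in the opposite direction, and the hexagon is formed by the possible
    orders of the moves [x], [x'], [z] that respect the two levels.

    Given these properties, induction on the height shows that two descending
    paths from [w] to [v] are equivalent ([geodesic_unique]: fill the hexagon
    below the first step where they part), and induction on the length shows
    that every path is equivalent to a descending one ([path_equiv_geodesic]).
    So the class of a path depends on its ends and its parity only, and the
    parity map from the fundamental group to Z/2 is injective.  It is onto since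
    [v] with odd parity is a vertex of the cover, hence is joined to the base
    point. *)

Set Implicit Arguments.
Unset Strict Implicit.
Unset Printing Implicit Defensive.

(** * Paths as sequences of edges *)

Section EdgePath.
Variable G : graph.
Implicit Types u v w : vertex G.

Lemma edge_path_edge u w (e : edge u w) i : i < 1 ->
  edge (if i is 0 then u else w) (if i.+1 is 0 then u else w).
Proof. by case: i. Qed.

Definition edge_path u w (e : edge u w) : gpath u w :=
  path_of (edge_path_edge e) erefl erefl.

Lemma gpath_last v w (p : gpath v w) n : plen p = n.+1 ->
  exists u (e : edge u w) (q : gpath v u),
    plen q = n /\ p = concat (edge_path e) q.
Proof.
move=> pn; have pw : pt p n.+1 = w by rewrite -pn pt_plen.
have e : edge (pt p n) w by have := @pt_edge _ _ _ p n; rewrite pn pw; apply.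
have fe i : i < n -> edge (pt p i) (pt p i.+1) by move=> ?; apply: pt_edge; lia.
exists (pt p n), e, (path_of fe (pt0 p) erefl); split=> //.
apply: gpath_eq; first by rewrite plen_concat /=; lia.
rewrite pn => i; rewrite leq_eqVlt => /predU1P[->|lei].
  rewrite pw.
  set q := path_of _ _ _; have <- : plen (concat (edge_path e) q) = n.+1.
    by rewrite plen_concat /=; lia.
  by rewrite pt_plen.
by rewrite pt_concatl /= ?pt_path_of.
Qed.

Lemma gpath_nil v w (p : gpath v w) : plen p = 0 -> v = w.
Proof. by move=> p0; rewrite -(pt_plen p) p0 pt0. Qed.

(** Such paths agree at both ends, which leaves at most [r - 1] positions where
    they may differ.  For [r = 3] this is what fills hexagons. *)
Lemma path_equiv_short r v w (p q : gpath v w) :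
  0 < r -> plen p = plen q -> plen p <= r -> path_equiv r p q.
Proof.
move=> r0 epq ler; apply: rst_step; right; split=> //.
rewrite (card_count _ (fun i => `[< pt p i <> pt q i >])).
have s0 : `[< pt p 0 <> pt q 0 >] = false by apply/asboolPn; rewrite !pt0.
have sn : `[< pt p (plen p) <> pt q (plen p) >] = false.
  by apply/asboolPn; rewrite pt_plen epq pt_plen.
rewrite /= s0 add0n; case: (plen p) ler sn => // n ler sn.
rewrite -[X in iota 1 X]addn1 iotaD count_cat /= add1n sn !addn0.
by apply: leq_ltn_trans (count_size _ _) _; rewrite size_iota.
Qed.

Lemma edge_pathK r u w (e : edge u w) (e' : edge w u) :
  path_equiv r (concat (edge_path e') (edge_path e)) (const_path u).
Proof.
have -> : edge_path e' = Defs.rev_path (edge_path e).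
  apply: gpath_eq => // i lei; rewrite pt_rev //= !pt_path_of ?leq_subr //.
  by case: i lei => [|[]].
exact: concat_rev.
Qed.

End EdgePath.

(** * Graphs with a hexagonal height *)

(** The Boolean is the parity of the position of a vertex on a path from [v], so
    [h] is a height function on the bipartite double cover of [G].  The last
    field asks for a hexagon [w, u, a, m, a', u'] of which [w] is the top and
    [m] the bottom; the heights of [a] and [a'] are then forced. *)
Record hexagonal_height (G : graph) (v : vertex G) (h : bool -> vertex G -> nat)
  : Prop := HexagonalHeight {
  height_base : h false v = 0;
  height_eq0 : forall b w, h b w = 0 -> b = false /\ w = v;
  height_edge : forall b u w, edge u w ->
    h b w = (h (~~ b) u).+1 \/ h (~~ b) u = (h b w).+1;
  height_descent : forall b w, 0 < h b w ->
    exists u, edge u w /\ h b w = (h (~~ b) u).+1;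
  height_hexagon : forall b w u u', edge u w -> edge u' w -> u <> u' ->
    h b w = (h (~~ b) u).+1 -> h b w = (h (~~ b) u').+1 ->
    exists a a' m, [/\ edge a u, edge a' u', edge m a, edge m a' &
      h b w = (h (~~ b) m).+3] }.

Section HexagonalHeight.
Variables (G : graph) (v : vertex G) (h : bool -> vertex G -> nat).
Hypothesis hh : hexagonal_height v h.

(** A path of length [n] cannot climb higher than [n]; the geodesics are those
    that go up at every step. *)
Definition geodesic w (p : gpath v w) := plen p = h (odd (plen p)) w.

Lemma geodesic_exists b w : exists p : gpath v w, geodesic p /\ odd (plen p) = b.
Proof.
have [n] := ubnP (h b w); elim: n b w => // n IH b w ltn.
have [h0|/(height_descent hh)[u [e hu]]] := posnP (h b w).
  have [-> ->] := height_eq0 hh h0.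
  by exists (const_path v); rewrite /geodesic /= (height_base hh).
have [|p [gp op]] := IH (~~ b) u; first by lia.
exists (concat (edge_path e) p).
rewrite /geodesic plen_concat addn1 /= op negbK; split=> //.
by rewrite hu gp op.
Qed.

Lemma plen_height w (p : gpath v w) : h (odd (plen p)) w <= plen p.
Proof.
move pn: (plen p) => n; elim: n w p pn => [|n IH] w p pn.
  by rewrite -(gpath_nil pn) (height_base hh).
have [u [e [q [qn _]]]] := gpath_last pn.
by have := IH _ _ qn; have := height_edge hh (odd n.+1) e; rewrite /= negbK; lia.
Qed.

Lemma geodesic_rcons u w (e : edge u w) (p : gpath v u) : geodesic p ->
  h (~~ odd (plen p)) w = (h (odd (plen p)) u).+1 ->
  geodesic (concat (edge_path e) p).
Proof. by rewrite /geodesic plen_concat addn1 /= => gp ->; rewrite -gp. Qed.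

Lemma geodesic_belast u w (e : edge u w) (p : gpath v u) :
  geodesic (concat (edge_path e) p) ->
  geodesic p /\ h (~~ odd (plen p)) w = (h (odd (plen p)) u).+1.
Proof.
rewrite /geodesic plen_concat addn1 /= => gp; have := plen_height p.
by have := height_edge hh (~~ odd (plen p)) e; rewrite negbK; lia.
Qed.

(** If the last steps of two geodesics to [w] come from different vertices [u]
    and [u'], the hexagon below [w], [u], [u'] has a bottom [m].  A geodesic to
    [m] continued along either side of the hexagon gives geodesics to [u] and to
    [u'], to which the induction hypothesis applies, and the two sides of the
    hexagon are paths of length 3 with the same ends. *)
Lemma geodesic_unique w (p q : gpath v w) :
  geodesic p -> geodesic q -> plen p = plen q -> path_equiv 3 p q.
Proof.
have [n] := ubnP (plen p); elim: n w p q => // n IH w p q.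
case pn: (plen p) => [|l] ltn gp gq epq.
  by apply: path_equiv_short; rewrite ?pn.
have [u [e [p' [p'l pE]]]] := gpath_last pn.
have [u' [e' [q' [q'l qE]]]] := gpath_last (esym epq).
move: gp gq; rewrite {}pE {}qE => /geodesic_belast[gp' hu] /geodesic_belast[gq' hu'].
rewrite p'l in hu; rewrite q'l in hu'.
have [euu'|neuu'] := pselect (u = u').
  case: u' / euu' e' q' q'l gq' hu' => e' q' q'l gq' hu'.
  apply: path_equiv_concat; first exact: path_equiv_short.
  by apply: IH => //; lia.
have [||a [a' [m [eau ea'u' ema ema' hm]]]] :=
  height_hexagon hh (b := ~~ odd l) e e' neuu'; rewrite ?negbK //.
rewrite negbK in hm.
(* The vertex m has the parity of l, being two steps before u. *)
have [g [gg og]] := geodesic_exists (odd l) m.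
have gl : l = (plen g).+2 by have := gg; have := gp'; rewrite /geodesic og p'l; lia.
have down x y (f : edge m x) (f' : edge x y) (s : gpath v y) : geodesic s ->
    plen s = l -> path_equiv 3 s (concat (edge_path f') (concat (edge_path f) g)).
  move=> gs sl; apply: IH => //; first by lia.
    have hx := height_edge hh (~~ odd l) f.
    have hy := height_edge hh (odd l) f'.
    have hs : l = h (odd l) y by rewrite -{1}sl gs sl.
    rewrite negbK in hx.
    have hg : plen g = h (odd l) m by rewrite gg og.
    have gf : geodesic (concat (edge_path f) g).
      by apply: geodesic_rcons => //; rewrite og; lia.
    apply: geodesic_rcons => //; rewrite plen_concat addn1 /= og negbK; lia.
  by rewrite !plen_concat /=; lia.
apply: (rst_trans _ _ _ (concat (edge_path e)
    (concat (edge_path eau) (concat (edge_path ema) g)))).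
  by apply: path_equiv_concat; [apply: rst_refl | apply: down].
apply: (rst_trans _ _ _ (concat (edge_path e')
    (concat (edge_path ea'u') (concat (edge_path ema') g)))).
  rewrite !concatA; apply: path_equiv_concat; last exact: rst_refl.
  exact: path_equiv_short.
by apply: path_equiv_concat; [apply: rst_refl | apply/rst_sym/down].
Qed.

(** Replace all but the last step of [p] by a geodesic.  If the last step goes
    up, the result is a geodesic; if it goes down, the geodesic to the previous
    vertex may be chosen to pass through [w], and the last step then retraces
    its last edge. *)
Lemma path_equiv_geodesic w (p g : gpath v w) :
  geodesic g -> odd (plen p) = odd (plen g) -> path_equiv 3 p g.
Proof.
move=> gg; move pn: (plen p) => n; elim: n w p g pn gg => [|n IH] w p g pn gg opg.
  have gp : geodesic p.
    by rewrite /geodesic pn -(gpath_nil pn) (height_base hh).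
  by apply: geodesic_unique; rewrite // gp gg pn -opg.
have [u [e [q [qn pE]]]] := gpath_last pn.
have [g' [gg' og']] := geodesic_exists (odd n) u.
have qg' : path_equiv 3 q g' by apply: IH; rewrite ?qn.
apply: (rst_trans _ _ _ (concat (edge_path e) g')).
  by rewrite pE; apply: path_equiv_concat; [apply: rst_refl|].
have og : odd (plen g) = ~~ odd n by rewrite -opg.
have := height_edge hh (~~ odd n) e; rewrite negbK => -[hw|hu].
  apply: geodesic_unique => //; first by apply: geodesic_rcons; rewrite // og'.
  by rewrite plen_concat addn1 gg gg' og og' hw.
apply: (rst_trans _ _ _ (concat (edge_path e) (concat (edge_path (edge_sym e)) g))).
  apply: path_equiv_concat; first exact: rst_refl.
  apply: geodesic_unique => //.
    by apply: geodesic_rcons; rewrite // og negbK.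
  by rewrite plen_concat addn1 gg gg' og og' hu.
rewrite concatA -[X in clos_refl_sym_trans _ _ _ X]concat_constl.
by apply: path_equiv_concat; [apply: edge_pathK | apply: rst_refl].
Qed.

Lemma path_equiv_same_parity w (p q : gpath v w) :
  odd (plen p) = odd (plen q) -> path_equiv 3 p q.
Proof.
move=> opq; have [g [gg og]] := geodesic_exists (odd (plen p)) w.
apply: (rst_trans _ _ _ g); first exact: path_equiv_geodesic.
by apply/rst_sym/path_equiv_geodesic; rewrite // -opq.
Qed.

End HexagonalHeight.

(** * The odd graph and the middle levels *)

Lemma card_setIU1 (T : finType) (x : T) (A B : {set T}) : x \notin B ->
  #|A :&: (x |: B)| = (x \in A) + #|A :&: B|.
Proof.
move=> xB; rewrite (cardsD1 x) in_setI setU11 andbT; congr (_ + #|pred_of_set _|).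
by apply/setP => y; rewrite !inE; case: eqP => [->|]; rewrite ?(negPf xB) ?andbF.
Qed.

Lemma card_setDU1 (T : finType) (x : T) (A B : {set T}) : x \notin B ->
  #|A :\: B| = (x \in A) + #|A :\: (x |: B)|.
Proof.
move=> xB; rewrite (cardsD1 x) in_setD xB; congr (_ + #|pred_of_set _|).
by apply/setP => y; rewrite !inE negb_or andbA.
Qed.

Section OddGraph.
Variable k : nat.
Notation V := (vertex (kneser (2 * k + 1) k)).
Notation I := 'I_(2 * k + 1).
Implicit Types (u v w : V) (x : I).
Definition kset w : {set I} := val w.

Lemma card_kset w : #|kset w| = k. Proof. exact/eqP/(valP w). Qed.

Lemma card_flip x w : x \notin kset w -> #|~: (x |: kset w)| == k.
Proof.
move=> xw; apply/eqP; have := cardsC (x |: kset w).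
by rewrite cardsU1 xw card_kset card_ord; lia.
Qed.

Definition flip x w (xw : x \notin kset w) : V :=
  exist (fun A : {set I} => #|A| == k) (~: (x |: kset w)) (card_flip xw).

(** A neighbour of [w] is the complement of [w] with one more point, which is
    therefore a name for the edge. *)
Lemma edge_flip x w (xw : x \notin kset w) : edge (flip xw) w.
Proof. by rewrite /= /kneser_edge /= disjoints_subset setCS subsetUr. Qed.

Lemma edge_flipP u w : edge u w -> exists x (xw : x \notin kset w), u = flip xw.
Proof.
move=> /= e; have /cards1P[x ex] : #|~: (kset u :|: kset w)| == 1.
  have := cardsC (kset u :|: kset w); rewrite cardsU (disjoint_setI0 e).
  by rewrite cards0 !card_kset card_ord; lia.
have xuw : x \notin kset u :|: kset w by rewrite -in_setC ex set11.
have xw : x \notin kset w by apply: contra xuw => xw; rewrite inE xw orbT.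
exists x, xw; apply/val_inj/eqP.
rewrite eqEcard (eqP (card_flip xw)) [#|_|]card_kset leqnn andbT.
rewrite subsetC subUset sub1set inE -/(kset u).
rewrite -disjoints_subset disjoint_sym e andbT.
by apply: contra xuw => xu; rewrite inE xu.
Qed.

(** This is the Hamming distance from [v] to [w] for even parity, and from [v] to
    the complement of [w] for odd parity. *)
Definition height v b w :=
  if b then 2 * #|kset v :&: kset w| + 1 else 2 * #|kset v :\: kset w|.

(** In the middle levels, the edge named by [x] puts [x] into the set [w] when the
    parity is even, and removes [x] from the complement of [w] when it is odd.
    This step gets closer to [v] if and only if [x] belongs to [v] in the first case,
    and does not in the second. *)
Lemma height_flip v b x w (xw : x \notin kset w) :
  if (x \in kset v) == ~~ b then height v b w = (height v (~~ b) (flip xw)).+1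
  else height v (~~ b) (flip xw) = (height v b w).+1.
Proof.
case: b => /=; rewrite /height /kset /= -/(kset v) -/(kset w).
  rewrite setDE setCK (card_setIU1 _ xw) /reverse_coercion.
  by case: (x \in kset v) => /=; lia.
rewrite -setDE (card_setDU1 _ xw) /reverse_coercion.
by case: (x \in kset v) => /=; lia.
Qed.

Lemma height_flip_lower v b x w (xw : x \notin kset w) :
  (x \in kset v) = ~~ b <-> height v b w = (height v (~~ b) (flip xw)).+1.
Proof. by have := height_flip v b xw; case: eqP => // xv ?; split=> //; lia. Qed.

Lemma exists_lower_flip v b w : 0 < height v b w ->
  exists2 x, x \notin kset w & (x \in kset v) = ~~ b.
Proof.
rewrite /height; case: b => /= [_|]; last first.
  rewrite muln_gt0 /= => /card_gt0P[x]; rewrite inE => /andP[xw xv].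
  by exists x.
have /card_gt0P[x] : 0 < #|~: (kset v :|: kset w)|.
  by have := cardsC (kset v :|: kset w); rewrite cardsU !card_kset card_ord; lia.
by rewrite !inE negb_or => /andP[/negbTE xv xw]; exists x.
Qed.

(** Cardinalities force an element to be moved in the other direction: for even
    parity, [w] and [v] have the same size, so that [w] is not included in [v]
    as [v] is not included in [w]; for odd parity, [x] and [x'] lie outside
    both [v] and [w], which leaves too little room for [v] and [w] to be disjoint. *)
Lemma exists_opposite v b w x x' : x != x' -> x \notin kset w -> x' \notin kset w ->
  (x \in kset v) = ~~ b -> (x' \in kset v) = ~~ b ->
  exists2 z, z \in kset w & (z \in kset v) = b.
Proof.
move=> nxx' xw x'w; case: b => /= xv x'v.
  have /card_gt0P[z] : 0 < #|kset v :&: kset w|; last first.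
    by rewrite inE => /andP[zv zw]; exists z.
  have : [set x; x'] \subset ~: (kset v :|: kset w).
    by rewrite subUset !sub1set !inE xv x'v (negPf xw) (negPf x'w).
  move=> /subset_leq_card; rewrite cards2 nxx'.
  have := cardsC (kset v :|: kset w); rewrite cardsU !card_kset card_ord.
  by rewrite /reverse_coercion /=; lia.
have /card_gt0P[z] : 0 < #|kset w :\: kset v|; last first.
  by rewrite inE => /andP[/negbTE zv zw]; exists z.
have : 0 < #|kset v :\: kset w| by apply/card_gt0P; exists x; rewrite inE xw.
have := cardsID (kset v) (kset w); have := cardsID (kset w) (kset v).
by rewrite setIC !card_kset; lia.
Qed.

Lemma hexagonal_height_odd_graph v : hexagonal_height v (height v).
Proof.
split.
- by rewrite /height setDv cards0.
- move=> [] w; rewrite /height; first by lia.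
  move=> /eqP; rewrite muln_eq0 /= cards_eq0 setD_eq0 => vw; split=> //.
  apply/val_inj/esym/eqP; rewrite eqEcard vw.
  by rewrite [#|_|]card_kset [X in _ <= X]card_kset leqnn.
- move=> b u w /edge_flipP[x [xw ->]].
  by have := height_flip v b xw; case: eqP => _; [left | right].
- move=> b w /exists_lower_flip[x xw xv]; exists (flip xw).
  by split; [exact: edge_flip | exact/height_flip_lower].
move=> b w _ _ /edge_flipP[x [xw ->]] /edge_flipP[x' [x'w ->]] neq.
move=> /height_flip_lower xv /height_flip_lower x'v.
have nxx' : x != x'.
  by apply: contra_notN neq => /eqP exx'; apply: val_inj; rewrite /= exx'.
have [z zw zv] := exists_opposite nxx' xw x'w xv x'v.
have zu y (yw : y \notin kset w) : z \notin kset (flip yw).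
  by rewrite /kset /= -/(kset w) !inE zw orbT.
have xa y y' (yw : y \notin kset w) : y' \notin kset w -> y' != y ->
    y' \notin kset (flip (zu y yw)).
  move=> /negbTE y'w /negbTE nyy'; rewrite /kset /= -/(kset w) !inE nyy' y'w.
  by rewrite orbF negbK orbT.
have x'a : x' \notin kset (flip (zu x xw)) by apply: xa; rewrite // eq_sym.
have xa' : x \notin kset (flip (zu x' x'w)) by apply: xa.
(* Moving x, z, x' or x', z, x in this order leads to the same vertex m. *)
exists (flip (zu x xw)), (flip (zu x' x'w)), (flip x'a).
split; try exact: edge_flip.
  rewrite (_ : flip _ = flip xa'); first exact: edge_flip.
  apply: val_inj; rewrite /kset /= -/(kset w); congr (~: _)%SET.
  have neqz y (yw : y \notin kset w) : (y == z) = false.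
    by apply: contraNF yw => /eqP->.
  apply/setP => y; rewrite !inE.
  have [->|_] := eqVneq y x; first by rewrite neqz // orbT.
  by have [->|//] := eqVneq y x'; rewrite neqz.
rewrite (height_flip_lower v b xw).1 //.
rewrite (height_flip_lower v (~~ b) (zu x xw)).1 ?negbK //.
by rewrite (height_flip_lower v b x'a).1.
Qed.

End OddGraph.

(** * The fundamental group *)

(* The set notations of this library hide those for finite sets. *)
From mathcomp Require Import classical_sets.

Section FundamentalGroup.
Variables (G : graph) (v : vertex G) (h : bool -> vertex G -> nat).
Hypothesis hh : hexagonal_height v h.

Lemma pi1_parity_inj : injective (@pi1_parity G 3 v).
Proof.
move=> a b; rewrite -(pi1_repr a) -(pi1_repr b) !pi1_parity_class => /(congr1 val).
rewrite /= !modn2 => eab; apply/pi1_classP/(path_equiv_same_parity hh).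
by case: (odd _) (odd _) eab => [] [].
Qed.

Lemma pi1_parity_bij : bijective (@pi1_parity G 3 v).
Proof.
(* A geodesic from v to v of odd length maps to the generator. *)
have parity (b : bool) : exists a : pi1 3 v, pi1_parity a = inZp (b : nat).
  have [g [_ og]] := geodesic_exists hh b v; exists (pi1_class 3 g).
  by rewrite pi1_parity_class; apply: val_inj; rewrite /= !modn2 og; case: b {og}.
have /choice[f fK] : forall i : 'Z_2, exists a : pi1 3 v, pi1_parity a = i.
  move=> i; have [a ha] := parity (i == inZp 1); exists a; rewrite {a}ha.
  by apply: val_inj; case: i => [[|[]]].
by exists f => // a; apply: pi1_parity_inj; rewrite fK.
Qed.

Lemma pi1_ev_trivial : pi1_ev 3 v = [set 1%g]%classic.
Proof.
have parity1 : pi1_parity (1%g : pi1 3 v) = 1%g.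
  by apply: etrans (pi1_parity_class 3 (const_path v)) _; apply: val_inj.
apply/seteqP; split=> a /=; last by move=> ->.
by rewrite /pi1_ev /= -parity1; apply: pi1_parity_inj.
Qed.

End FundamentalGroup.

Local Open Scope classical_set_scope.

Theorem proposition5p3 (k : nat) (hk : 0 < k) (v : vertex (kneser (2 * k + 1) k)) :
  pi1_ev 3 v = [set 1%g] /\
  exists f : {multiplicative pi1 3 v -> 'Z_2}, bijective f.
Proof.
have hh := hexagonal_height_odd_graph v.
split; first exact: pi1_ev_trivial hh.
by exists (@pi1_parity _ 3 v); apply: pi1_parity_bij hh.
Qed.
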